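(* Let $d\ge 2$ and $0\le k\le d-2$ be integers, let $\mathbf{K}$ be a convex body in $\mathbb{R}^d$, and let $\mathcal{K}=\{\mathbf{K}_i=\mathbf{x}_i+\tau_i\mathbf{K} : \mathbf{x}_i\in\mathbb{R}^d,\ \tau_i>0,\ i=1,2,\ldots,n\}$ be a $k$-IP-family of positive homothetic copies of $\mathbf{K}$ in $\mathbb{R}^d$. Then $\operatorname{conv}\bigcup\mathcal{K}$ slides freely inside $\left(\sum_{i=1}^n\tau_i\right)\mathbf{K}$ (i.e., $\operatorname{conv}\bigcup\mathcal{K}$ is a summand of $\left(\sum_{i=1}^n\tau_i\right)\mathbf{K}$), and therefore $\lambda_k(\mathcal{K})\le 1$.
   Context: A convex body in $\mathbb{R}^d$ is a compact convex subset of $\mathbb{R}^d$ with non-empty interior. A finite family $\mathcal{K}=\{\mathbf{x}_i+\tau_i\mathbf{K} : i=1,\ldots,n\}$ of positive homothetic copies ($\tau_i>0$) of $\mathbf{K}$ is a $k$-impassable family, in short a $k$-IP-family, if every $k$-dimensional affine subspace of $\mathbb{R}^d$ intersecting $\operatorname{conv}\left(\bigcup\mathcal{K}\right)$ intersects an element of $\mathcal{K}$. For a $k$-IP-family, $\lambda_k(\mathcal{K})>0$ denotes the smallest positive value $\lambda$ such that some translate of $\lambda\left(\sum_{i=1}^n\tau_i\right)\mathbf{K}$ covers $\bigcup\mathcal{K}$. Let $\mathbf{K}_1'$ and $\mathbf{K}_2'$ be convex bodies in $\mathbb{R}^d$. $\mathbf{K}_2'$ is a summand of $\mathbf{K}_1'$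 if there exists a non-empty compact convex set $\mathbf{K}'\subset\mathbb{R}^d$ with $\mathbf{K}_2'+\mathbf{K}'=\mathbf{K}_1'$ (Minkowski sum). $\mathbf{K}_2'$ slides freely inside $\mathbf{K}_1'$ if for each boundary point $\mathbf{x}$ of $\mathbf{K}_1'$ there exists a translation vector $\mathbf{y}\in\mathbb{R}^d$ such that $\mathbf{x}\in\mathbf{y}+\mathbf{K}_2'\subseteq\mathbf{K}_1'$. *)

(* Defs.v *)
From mathcomp Require Import all_boot all_order all_algebra.
From mathcomp Require Import all_classical all_reals all_analysis.

Set Implicit Arguments.
Unset Strict Implicit.
Unset Printing Implicit Defensive.

Import Order.TTheory GRing.Theory Num.Theory.
Import numFieldNormedType.Exports.

Local Open Scope classical_set_scope.
Local Open Scope ring_scope.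

(* The norm of 'rV[R]_d is the sup norm; it induces the Euclidean topology of
   R^d, and the notions below depend only on the topology. *)
Definition convex_body (R : realType) (d : nat) (K : set 'rV[R]_d) : Prop :=
  [/\ compact K, @convex_set R 'rV[R]_d K & interior K !=set0].

Definition translate (R : realType) (d : nat) (y : 'rV[R]_d)
    (A : set 'rV[R]_d) : set 'rV[R]_d :=
  [set y + u | u in A].

Definition dilate (R : realType) (d : nat) (t : R)
    (A : set 'rV[R]_d) : set 'rV[R]_d :=
  [set t *: u | u in A].

Definition homothet (R : realType) (d : nat) (K : set 'rV[R]_d)
    (y : 'rV[R]_d) (t : R) : set 'rV[R]_d :=
  translate y (dilate t K).

Definition minkowski_sum (R : realType) (d : nat)
    (A B : set 'rV[R]_d) : set 'rV[R]_d :=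
  [set u + v | u in A & v in B].

Definition convex_hull (R : realType) (d : nat)
    (A : set 'rV[R]_d) : set 'rV[R]_d :=
  smallest (@convex_set R 'rV[R]_d) A.

Definition boundary (R : realType) (d : nat)
    (A : set 'rV[R]_d) : set 'rV[R]_d :=
  closure A `\` interior A.

Definition affine_subspace (R : realType) (d k : nat)
    (L : set 'rV[R]_d) : Prop :=
  exists (p : 'rV[R]_d) (V : {vspace 'rV[R]_d}),
    \dim V = k /\ L = translate p [set v | v \in V].

Definition impassable (R : realType) (d k n : nat)
    (F : 'I_n -> set 'rV[R]_d) : Prop :=
  forall L : set 'rV[R]_d, affine_subspace k L ->
    L `&` convex_hull (\bigcup_i F i) !=set0 ->
    exists i : 'I_n, L `&` F i !=set0.

Definition summand (R : realType) (d : nat) (K2 K1 : set 'rV[R]_d) : Prop :=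
  exists C : set 'rV[R]_d,
    [/\ C !=set0, compact C, @convex_set R 'rV[R]_d C
      & minkowski_sum K2 C = K1].

Definition slides_freely (R : realType) (d : nat)
    (K2 K1 : set 'rV[R]_d) : Prop :=
  forall x : 'rV[R]_d, boundary K1 x ->
    exists y : 'rV[R]_d, translate y K2 x /\ translate y K2 `<=` K1.

Definition covering_ratio (R : realType) (d n : nat) (K : set 'rV[R]_d)
    (x : 'I_n -> 'rV[R]_d) (tau : 'I_n -> R) (l : R) : Prop :=
  0 < l /\
  exists y : 'rV[R]_d,
    \bigcup_i homothet K (x i) (tau i)
      `<=` translate y (dilate (l * \sum_(i < n) tau i) K).

(* [is_lambda K x tau l] says that l is the smallest positive covering ratio.
   A relation, rather than an infimum, makes attainment of the minimum explicit
   and avoids default values. The dimension k of the impassability assumption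
   does not enter the covering condition. *)
Definition is_lambda (R : realType) (d n : nat) (K : set 'rV[R]_d)
    (x : 'I_n -> 'rV[R]_d) (tau : 'I_n -> R) (l : R) : Prop :=
  covering_ratio K x tau l /\
  forall m : R, covering_ratio K x tau m -> l <= m.

(* Main.v *)
Require Import Defs.
From mathcomp Require Import all_boot all_order all_algebra.
From mathcomp Require Import all_classical all_reals all_analysis.
From mathcomp Require Import lra ring.

(** Write [h_A u] for the support function [supportf A u] of [A], [T] for the
    sum of the ratios, [H] for the hull of the homothets [K_i] and [S] for
    [T *: K]. The hull [H] is a summand of [S] as soon as [g = T * h_K - h_H]
    is sublinear: [g] is then the support function of a compact convex set [C]
    by the Hahn-Banach theorem, and [H + C] and [S], having equal support
    functions, coincide ([summand_defect]).

    Positive homogeneity of [g] is clear. Its subadditivity says that the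
    defect [h_A u + h_A v - h_A (u + v)] for [A = H] is at most the one for
    [A = S]. The defect of [S] is the sum of the defects of the [K_i], so it
    suffices that the defect of [H] is at most this sum ([defect_le_sum]). For
    fixed [u] and [v] only the images under [z |-> (dot z u, dot z v)] matter,
    and this is where impassability enters: every fibre of that map contains a
    [k]-flat through any of its points because [k <= d - 2], so the image of
    [H] is the union of the images of the [K_i] ([impassable_fibre]).

    There remains a statement about a planar compact convex set covered by
    finitely many compact pieces contained in it. Call the coordinates [p] and
    [q], and let [E] be a point where [p + q] is largest. The defect of the set
    is the [p]-extent of its boundary arc from [E] to a rightmost point, plus
    the [q]-extent of the arc from [E] to a highest point. Each point of these
    arcs lies in some piece, and the part of the arcs covered by one piece has
    extent at most the defect of that piece ([meets_top_defect],
    [meets_top_right_defect]); since the parts cover, the extents add up to at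
    least the defect of the set ([interval_cover_le]).

    Both remaining conclusions follow from a decomposition [H + C = S]. A
    boundary point [h + c] of [S] lies in the translate of [H] by [c], which is
    contained in [S]; and any [c] in [C] translates [H], hence all the [K_i],
    into [S], so the ratio 1 is admissible. The least admissible ratio is
    attained because the pairs (ratio, centre) with ratio in [0, 1] that
    satisfy the covering inequalities between support functions form a compact
    set ([is_lambda_le1]). *)

Set Implicit Arguments.
Unset Strict Implicit.
Unset Printing Implicit Defensive.

Import Order.TTheory GRing.Theory Num.Theory.
Import numFieldNormedType.Exports.

Local Open Scope classical_set_scope.
Local Open Scope ring_scope.

(** * The dot product *)

Section Dot.
Context {R : realType} {d : nat}.
Implicit Types u v w : 'rV[R]_d.

Definition dot u v : R := \sum_j u 0 j * v 0 j.

Lemma dotC u v : dot u v = dot v u.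
Proof. by apply: eq_bigr => j _; rewrite mulrC. Qed.

Lemma dotDl u v w : dot (u + v) w = dot u w + dot v w.
Proof. by rewrite -big_split; apply: eq_bigr => j _; rewrite mxE mulrDl. Qed.

Lemma dotZl (t : R) u v : dot (t *: u) v = t * dot u v.
Proof. by rewrite mulr_sumr; apply: eq_bigr => j _; rewrite mxE mulrA. Qed.

Lemma dotDr u v w : dot u (v + w) = dot u v + dot u w.
Proof. by rewrite dotC dotDl !(dotC u). Qed.

Lemma dotZr (t : R) u v : dot u (t *: v) = t * dot u v.
Proof. by rewrite dotC dotZl (dotC u). Qed.

Lemma dotNl u v : dot (- u) v = - dot u v.
Proof. by rewrite -scaleN1r dotZl mulN1r. Qed.

Lemma dotNr u v : dot u (- v) = - dot u v.
Proof. by rewrite -scaleN1r dotZr mulN1r. Qed.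

Lemma dot_delta u j : dot u (delta_mx 0 j) = u 0 j.
Proof.
rewrite /dot (bigD1 j) //= !mxE !eqxx mulr1 big1 ?addr0 // => i /negPf ij.
by rewrite mxE ij andbF mulr0.
Qed.

Lemma dotxx_gt0 u : u != 0 -> 0 < dot u u.
Proof.
move=> u0; rewrite lt_def sumr_ge0 ?andbT => [|j _]; last exact: sqr_ge0.
apply: contra u0 => /eqP uu0; apply/eqP/rowP => j; rewrite mxE.
move/eqP: uu0; rewrite psumr_eq0 => [/allP|i _]; last exact: sqr_ge0.
by move=> /(_ j); rewrite mem_index_enum mulf_eq0 orbb => /(_ isT)/eqP.
Qed.

Lemma dot_continuous u : continuous (dot^~ u).
Proof.
apply: continuous_big => [|j _]; first exact: add_continuous.
by move=> z; apply: continuousM;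
  [exact: coord_continuous | exact: cst_continuous].
Qed.

Lemma dotxx_continuous : continuous (fun u => dot u u).
Proof.
apply: continuous_big => [|j _]; first exact: add_continuous.
by move=> z; apply: continuousM; exact: coord_continuous.
Qed.

End Dot.

(** * Convex sets, separation and support functions *)

Section Support.
Context {R : realType} {d : nat}.
Implicit Types (A B : set 'rV[R]_d) (u v s : 'rV[R]_d).

Lemma convex_setP A : @convex_set R 'rV[R]_d A <->
  forall z z' (t : R), 0 <= t <= 1 -> A z -> A z' ->
    A (t *: z + (1 - t) *: z').
Proof.
split=> [cA z z' t /andP[t0 t1] Az Az'|cA z z' t].
  have := cA z z' (Itv01 t0 t1); rewrite !inE; exact.
by rewrite !inE => Az Az'; apply: cA => //; apply/andP; split.
Qed.

(** The point of [A] nearest to [s] in Euclidean norm gives the separating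
    direction. *)
Lemma compact_convex_separation A s : compact A -> @convex_set R 'rV[R]_d A ->
  A !=set0 -> (forall u, exists2 z, A z & dot s u <= dot z u) -> A s.
Proof.
move=> Ac /convex_setP Av A0 As.
have [|c Ac0 cmin] :=
  EVT_min_rV (f := fun z : 'rV[R]_d => dot (s - z) (s - z)) A0 Ac.
  have sub_cont : continuous (fun z : 'rV[R]_d => s - z).
    by move=> z; apply: continuousB; [exact: cst_continuous | exact: cvg_id].
  apply: continuous_subspaceT.
  exact: (fun z => continuous_comp (sub_cont z) (@dotxx_continuous _ _ _)).
have {}Ac0 := set_mem Ac0.
have [->//|sc] := eqVneq s c.
have [z Az /=] := As (s - c).
have : 0 < dot (s - c) (s - c) by rewrite dotxx_gt0 // subr_eq0.
set a := s - c; set b := z - c => a0 saz.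
have ab : dot a a <= dot a b.
  have : dot a b = dot z a - dot c a by rewrite /b dotDr dotNr !(dotC a).
  move=> ->; rewrite {1}/a dotDl dotNl; lra.
have b0 : 0 <= dot b b.
  by apply: sumr_ge0 => j _; exact: sqr_ge0.
(* moving from c towards z by t changes the squared distance to s by
   t ^ 2 |b| ^ 2 - 2 t <a, b>, which is negative for the t below *)
pose t := dot a a / (dot a a + dot b b).
have den : 0 < dot a a + dot b b by rewrite ltr_wpDr.
have t0 : 0 < t by rewrite divr_gt0.
have t1 : t <= 1 by rewrite ler_pdivrMr // mul1r lerDl.
have tden : t * (dot a a + dot b b) = dot a a by rewrite divfK // gt_eqF.
have t01 : 0 <= t <= 1 by rewrite ltW.
have /= := cmin _ (mem_set (Av z c t t01 Az Ac0)).
rewrite -/a.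
have -> : s - (t *: z + (1 - t) *: c) = a - t *: b.
  by apply/rowP => j; rewrite !mxE; ring.
clearbody a b.
rewrite !(dotDl, dotDr, dotNl, dotNr, dotZl, dotZr) (dotC b a) => h.
exfalso; nra.
Qed.

Definition supportf A u : R := sup [set dot z u | z in A].

Lemma supportf_ub A u z : compact A -> A z -> dot z u <= supportf A u.
Proof.
move=> Ac Az; have A0 : A !=set0 by exists z.
have [|c Ac0 cmax] := EVT_max_rV (f := dot^~ u) A0 Ac.
  by apply: continuous_subspaceT; exact: dot_continuous.
apply: ub_le_sup; last by exists z.
by exists (dot c u) => _ [w Aw <-]; apply: cmax; exact: mem_set.
Qed.

Lemma supportf_le A u (m : R) : A !=set0 ->
  (forall z, A z -> dot z u <= m) -> supportf A u <= m.
Proof.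
move=> [z Az] Am; apply: ge_sup; first by exists (dot z u), z.
by move=> _ [w Aw <-]; exact: Am.
Qed.

Lemma supportf_attained A u : compact A -> A !=set0 ->
  exists2 z, A z & dot z u = supportf A u.
Proof.
move=> Ac A0; have [|c Ac0 cmax] := EVT_max_rV (f := dot^~ u) A0 Ac.
  by apply: continuous_subspaceT; exact: dot_continuous.
exists c; first exact: set_mem.
apply/eqP; rewrite eq_le supportf_ub //=; last exact: set_mem.
by apply: supportf_le => // w Aw; apply: cmax; exact: mem_set.
Qed.

Lemma supportf_subset A B u : compact B -> A !=set0 -> A `<=` B ->
  supportf A u <= supportf B u.
Proof.
by move=> Bc A0 AB; apply: supportf_le => // z /AB; exact: supportf_ub.
Qed.

Lemma supportfD A u v : compact A -> A !=set0 ->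
  supportf A (u + v) <= supportf A u + supportf A v.
Proof.
by move=> Ac A0; apply: supportf_le => // z Az; rewrite dotDr lerD ?supportf_ub.
Qed.

Lemma supportfZ A (t : R) u : 0 <= t -> compact A -> A !=set0 ->
  supportf A (t *: u) = t * supportf A u.
Proof.
move=> t0 Ac A0; apply/eqP; rewrite eq_le; apply/andP; split.
  by apply: supportf_le => // z Az; rewrite dotZr ler_wpM2l // supportf_ub.
by have [z Az <-] := supportf_attained u Ac A0; rewrite -dotZr supportf_ub.
Qed.

Lemma mem_supportfP A s : compact A -> @convex_set R 'rV[R]_d A -> A !=set0 ->
  A s <-> forall u, dot s u <= supportf A u.
Proof.
move=> Ac Av A0; split=> [As u|sA]; first exact: supportf_ub.
apply: compact_convex_separation => // u.
by have [z Az zu] := supportf_attained u Ac A0; exists z; rewrite ?zu.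
Qed.

End Support.

(** * The Hahn-Banach theorem in finite dimension *)

Section HahnBanach.
Context {R : realType} {d : nat}.
Implicit Types (p q g : 'rV[R]_d -> R) (u v w : 'rV[R]_d).

Definition sublinear p : Prop :=
  (forall u v, p (u + v) <= p u + p v) /\
  (forall (t : R) u, 0 <= t -> p (t *: u) = t * p u).

Lemma sublinear0 p : sublinear p -> p 0 = 0.
Proof. by move=> [_ pZ]; rewrite -(scale0r 0) pZ // mul0r. Qed.

Lemma sublinearN p u : sublinear p -> - p (- u) <= p u.
Proof.
move=> ps; have := ps.1 u (- u); rewrite subrr sublinear0 //; lra.
Qed.

(** The largest sublinear minorant of [p] that is linear along the line spanned
    by [w] and agrees with [p] at [w]. *)
Definition linearize p w u : R :=
  inf [set p (u + t *: w) - t * p w | t in [set t | 0 <= t]].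

Lemma linearize_le p w u (t : R) : sublinear p -> 0 <= t ->
  linearize p w u <= p (u + t *: w) - t * p w.
Proof.
move=> ps t0; apply: ge_inf; last by exists t.
exists (- p (- u)) => _ [r r0 <-]; rewrite -(ps.2 r w r0).
have := ps.1 (u + r *: w) (- u); rewrite addrAC subrr add0r; lra.
Qed.

Lemma linearize_ge p w u (m : R) :
  (forall t, 0 <= t -> m <= p (u + t *: w) - t * p w) -> m <= linearize p w u.
Proof.
move=> mle; apply: lb_le_inf.
  by exists (p (u + 0 *: w) - 0 * p w), 0 => /=.
by move=> _ [t t0 <-]; exact: mle.
Qed.

Lemma linearize_sublinear p w : sublinear p -> sublinear (linearize p w).
Proof.
move=> ps.
have scale_le (c : R) u :
    0 < c -> linearize p w (c *: u) <= c * linearize p w u.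
  move=> c0; rewrite mulrC -ler_pdivrMr //; apply: linearize_ge => t t0.
  rewrite ler_pdivrMr //.
  apply: le_trans (linearize_le w (c *: u) ps (mulr_ge0 (ltW c0) t0)) _.
  rewrite -scalerA -scalerDr (ps.2 _ _ (ltW c0)).
  by rewrite le_eqVlt; apply/orP; left; apply/eqP; ring.
split=> [u v|c u].
  rewrite -lerBlDr; apply: linearize_ge => t t0.
  rewrite lerBlDl -lerBlDr; apply: linearize_ge => r r0.
  have := linearize_le w (u + v) ps (addr_ge0 t0 r0).
  have := ps.1 (u + t *: w) (v + r *: w).
  rewrite addrACA -scalerDl; lra.
rewrite le_eqVlt => /predU1P[<-|c0].
  rewrite scale0r mul0r; apply/eqP; rewrite eq_le; apply/andP; split.
    have := linearize_le w 0 ps (lexx 0).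
    by rewrite scale0r add0r mul0r subr0 (sublinear0 ps).
  by apply: linearize_ge => t t0; rewrite add0r ps.2 // subrr.
apply/eqP; rewrite eq_le scale_le //= mulrC -ler_pdivlMr // mulrC.
rewrite -[X in linearize p w X <= _](scalerK (lt0r_neq0 c0)).
by apply: scale_le; rewrite invr_gt0.
Qed.

(** For sublinear [q] the condition [q (- w) <= - q w] means linearity along
    [w]. It passes to any smaller sublinear [r], since
    [r (- w) <= q (- w) <= - q w <= - r w]; so the vectors can be treated one
    after the other. *)
Lemma sublinear_minorant p (ws : seq 'rV[R]_d) : sublinear p ->
  exists q, [/\ sublinear q, forall u, q u <= p u
    & forall w, w \in ws -> q (- w) <= - q w].
Proof.
elim: ws p => [|w ws IH] p ps; first by exists p.
have [q [qs qp qw]] := IH _ (linearize_sublinear w ps).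
have linp u : linearize p w u <= p u.
  by have := linearize_le w u ps (lexx 0); rewrite scale0r addr0 mul0r subr0.
exists q; split=> [//|u|v]; first exact: le_trans (qp u) (linp u).
rewrite inE => /predU1P[->|]; last exact: qw.
have := linearize_le w (- w) ps ler01.
rewrite scale1r addNr mul1r sublinear0 //.
have := qp (- w); have := qp w; have := linp w; lra.
Qed.

(** Hahn-Banach: linearizing along [u0] fixes the value at [u0], and
    linearizing further along a basis leaves a linear function. *)
Lemma sublinear_supporting_dot g u0 : sublinear g ->
  exists c : 'rV[R]_d, (forall u, dot c u <= g u) /\ dot c u0 = g u0.
Proof.
move=> gs.
have [q [qs qg qe]] := sublinear_minorant [seq delta_mx 0 j | j <- enum 'I_d]
  (linearize_sublinear u0 gs).
pose c : 'rV[R]_d := \row_j q (delta_mx 0 j).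
have qc u : q u <= dot c u.
  rewrite [in leLHS](row_sum_delta u).
  apply: (@le_trans _ _ (\sum_j q (u 0 j *: delta_mx 0 j))).
    elim/big_rec2: _ => [|j a b _ ab]; first by rewrite sublinear0.
    by apply: le_trans (qs.1 _ _) _; rewrite lerD2l.
  apply: ler_sum => j _; rewrite mxE mulrC.
  have [u0j|uj0] := leP 0 (u 0 j); first by rewrite qs.2.
  have Nuj : 0 <= - u 0 j by rewrite oppr_ge0 ltW.
  have qj : q (- delta_mx 0 j) <= - q (delta_mx 0 j).
    by apply: qe; apply: map_f; rewrite mem_enum.
  rewrite -[u 0 j]opprK scaleNr -scalerN qs.2 // [leRHS]mulNr -mulrN.
  exact: ler_wpM2l.
have cq u : dot c u = q u.
  apply/eqP; rewrite eq_le qc andbT.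
  have := qc (- u); rewrite dotNr => h.
  by have := sublinearN u qs; lra.
have ling u : linearize g u0 u <= g u.
  by have := linearize_le u0 u gs (lexx 0); rewrite scale0r addr0 mul0r subr0.
exists c; split=> [u|]; first by rewrite cq (le_trans (qg u)).
apply/eqP; rewrite cq eq_le (le_trans (qg u0)) //=.
have := linearize_le u0 (- u0) gs ler01.
rewrite scale1r addNr mul1r sublinear0 //.
have := qg (- u0); have := sublinearN u0 qs; lra.
Qed.

End HahnBanach.

(** * A criterion for summands in terms of support functions *)

Section Summand.
Context {R : realType} {d : nat}.
Implicit Types (A B H S : set 'rV[R]_d) (u v : 'rV[R]_d).

Definition defect A u v : R := supportf A u + supportf A v - supportf A (u + v).

Lemma closed_halfspace u (m : R) : closed [set c : 'rV[R]_d | dot c u <= m].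
Proof.
apply: (@closed_comp _ _ (dot^~ u) [set x | x <= m]); last exact: closed_le.
by move=> z _; exact: dot_continuous.
Qed.

Definition wulff (g : 'rV[R]_d -> R) : set 'rV[R]_d :=
  [set c | forall u, dot c u <= g u].

Lemma wulff_compact g : compact (wulff g).
Proof.
pose e j : 'rV[R]_d := delta_mx 0 j.
apply: (@subclosed_compact _ _
  [set c : 'rV[R]_d | forall j, `[- g (- e j), g (e j)]%classic (c ord0 j)]).
- have -> : wulff g = \bigcap_(u in setT) [set c | dot c u <= g u].
    by apply/seteqP; split=> c cg u; [move=> _; exact: cg | exact: cg].
  by apply: closed_bigI => u _; exact: closed_halfspace.
- apply: (@rV_compact _ _ (fun j => `[- g (- e j), g (e j)]%classic)) => j.
  exact: segment_compact.
- move=> c cg j /=; rewrite in_itv /=.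
  by have := cg (e j); have := cg (- e j);
    rewrite dotNr dot_delta => h1 h2; apply/andP; split; lra.
Qed.

Lemma wulff_convex g : @convex_set R 'rV[R]_d (wulff g).
Proof.
apply/convex_setP => c c' t /andP[t0 t1] cg c'g u.
have /andP[s0 s1] : 0 <= 1 - t <= 1 by apply/andP; split; lra.
rewrite dotDl !dotZl.
have := ler_wpM2l t0 (cg u); have := ler_wpM2l s0 (c'g u); lra.
Qed.

Lemma minkowski_sum_compact A B : compact A -> compact B ->
  compact (minkowski_sum A B).
Proof.
move=> Ac Bc.
have -> : minkowski_sum A B = (fun z => z.1 + z.2) @` (A `*` B).
  apply/seteqP; split=> z; first by move=> [a Aa [b Bb <-]]; exists (a, b).
  by move=> [[a b] [/= Aa Bb] <-]; exists a => //; exists b.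
apply: continuous_compact; last exact: compact_setX.
by apply: continuous_subspaceT; exact: add_continuous.
Qed.

Lemma minkowski_sum_convex A B :
  @convex_set R 'rV[R]_d A -> @convex_set R 'rV[R]_d B ->
  @convex_set R 'rV[R]_d (minkowski_sum A B).
Proof.
move=> /convex_setP Av /convex_setP Bv; apply/convex_setP.
move=> _ _ t t01 [a Aa [b Bb <-]] [a' Aa' [b' Bb' <-]].
exists (t *: a + (1 - t) *: a'); first exact: Av.
exists (t *: b + (1 - t) *: b'); first exact: Bv.
by rewrite !scalerDr addrACA.
Qed.

(** If the difference [g] of the two support functions is subadditive, then it
    is the support function of its Wulff shape, which is therefore the missing
    Minkowski summand. *)
Lemma summand_defect H S :
  compact H -> @convex_set R 'rV[R]_d H -> H !=set0 ->
  compact S -> @convex_set R 'rV[R]_d S -> S !=set0 ->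
  (forall u v, defect H u v <= defect S u v) -> summand H S.
Proof.
move=> Hc Hv H0 Sc Sv S0 HS.
pose g u := supportf S u - supportf H u.
have gs : sublinear g.
  split=> [u v|t u t0]; last by rewrite /g !supportfZ // mulrBr.
  by have := HS u v; rewrite /defect /g; lra.
have C0 : wulff g !=set0.
  by have [c [cg _]] := sublinear_supporting_dot 0 gs; exists c.
exists (wulff g); split=> //; [exact: wulff_compact|exact: wulff_convex|].
apply/seteqP; split=> [_ [h Hh [c cg <-]]|s Ss].
  apply/mem_supportfP => // u; rewrite dotDl.
  by have := supportf_ub u Hc Hh; have := cg u; rewrite /g; lra.
apply: compact_convex_separation.
- exact: minkowski_sum_compact Hc (@wulff_compact g).
- exact: minkowski_sum_convex Hv (@wulff_convex g).
- by have [h Hh] := H0; have [c cg] := C0; exists (h + c), h => //; exists c.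
- move=> u; have [h Hh hu] := supportf_attained u Hc H0.
  have [c [cg cu]] := sublinear_supporting_dot u gs.
  exists (h + c); first by exists h => //; exists c.
  by rewrite dotDl hu cu /g; have := supportf_ub u Sc Ss; lra.
Qed.

End Summand.

(** * The defect of a planar union *)

(** By induction on the number of classes: the class of the left endpoint
    reaches at most [D i] to the right, and any point further right is covered
    by the remaining classes. *)
Lemma interval_cover_le {R : realType} {I : eqType} (D : I -> R)
    (P : I -> R -> Prop) (s : seq I) (a b : R) :
  (forall i, 0 <= D i) ->
  (forall i t t', P i t -> P i t' -> t <= t' -> t' - t <= D i) ->
  (forall t, a <= t <= b -> exists2 i, i \in s & P i t) ->
  b - a <= \sum_(i <- s) D i.
Proof.
move=> D0 PD; move: {2}(size s) (erefl (size s)) => m.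
elim: m s a => [|m IH] s a sm cov; have [ba|ab] := leP b a.
- by apply: (@le_trans _ _ 0); [rewrite subr_le0|exact: sumr_ge0].
- have [|i] := cov a; first by rewrite lexx ltW.
  by move/size0nil: sm => ->.
- by apply: (@le_trans _ _ 0); [rewrite subr_le0|exact: sumr_ge0].
have [|i si Pia] := cov a; first by rewrite lexx ltW.
rewrite (big_rem i) //=; set r := rem i s; set E := \sum_(j <- r) D j.
have tail t : a + D i < t -> b - t <= E.
  move=> ait; apply: IH => [|t' /andP[tt' t'b]].
    by rewrite size_rem // sm.
  have [|j sj Pj] := cov t'; first by have := D0 i; lra.
  exists j => //; apply: rem_mem => //; apply/eqP => ji.
  by rewrite ji in Pj; have := PD i a t' Pia Pj; have := D0 i; lra.
rewrite leNgt; apply/negP => big.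
have := tail (b - (E + (b - a - D i)) / 2); lra.
Qed.

Section Defect.
Context {R : realType} {d n : nat}.
Implicit Types (A : set 'rV[R]_d) (u v : 'rV[R]_d).

Lemma defectC A u v : defect A u v = defect A v u.
Proof. by rewrite /defect (addrC u) (addrC (supportf A u)). Qed.

Lemma defect_ge0 A u v : compact A -> A !=set0 -> 0 <= defect A u v.
Proof. by move=> Ac A0; rewrite subr_ge0 supportfD. Qed.

Variables (H : set 'rV[R]_d) (F : 'I_n -> set 'rV[R]_d).
Hypotheses (Hc : compact H) (Hv : @convex_set R 'rV[R]_d H).
Hypotheses (Fc : forall i, compact (F i)) (F0 : forall i, F i !=set0)
  (FH : forall i, F i `<=` H).

(** The top point is taken in the plane with coordinates [dot z u] and
    [dot z v], on the vertical line at abscissa [s]; exchanging [u] and [v]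
    gives the rightmost point on a horizontal line. *)
Definition meets_top u v (s : R) (i : 'I_n) : Prop :=
  exists z, [/\ F i z, dot z u = s &
    forall z', H z' -> dot z' u = s -> dot z' v <= dot z v].

Lemma meets_top_exists u v E s : H E -> dot E u <= s <= supportf H u ->
  (forall z, H z -> exists i, exists2 z', F i z' &
    dot z' u = dot z u /\ dot z' v = dot z v) ->
  exists i, meets_top u v s i.
Proof.
move=> HE /andP[Es su] cov; have H0 : H !=set0 by exists E.
have [A HA Au] := supportf_attained u Hc H0.
pose L := H `&` [set z | dot z u = s].
have L0 : L !=set0.
  have [EA|AE] := ltP (dot E u) (dot A u); last first.
    by exists E; split=> //=; lra.
  (* the point of the segment from E to A at abscissa s *)
  pose t := (s - dot E u) / (dot A u - dot E u).
  have den : 0 < dot A u - dot E u by lra.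
  have tden : t * (dot A u - dot E u) = s - dot E u by rewrite divfK // gt_eqF.
  have t0 : 0 <= t by apply: divr_ge0; lra.
  have t1 : t <= 1 by rewrite ler_pdivrMr // mul1r; lra.
  exists (t *: A + (1 - t) *: E); split.
    by apply: (iffLR (convex_setP H)) => //; apply/andP.
  by rewrite /= dotDl !dotZl; lra.
have Lc : compact L.
  apply: (@compact_closedI _ H) => //.
  apply: (@closed_comp _ _ (dot^~ u) [set x | x = s]); last exact: closed_eq.
  by move=> z _; exact: dot_continuous.
have [z [Hz zs] zv] := supportf_attained v Lc L0.
have [i [z' Fz' [zu' zv']]] := cov z Hz.
exists i, z'; split=> //; first by rewrite zu'.
by move=> w Hw ws; rewrite zv' zv; apply: supportf_ub.
Qed.

(** Since [dot _ u] reaches [s2] on [F i], it is enough that, for [z] in [F i],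
    [dot z u + dot z v] is at most [s1] plus the maximum of [dot _ v]. Left of
    [s1] this is immediate. To the right, the segment from [E] to [z] crosses
    the line at abscissa [s1] not above the top point, and along it
    [dot _ (u + v)] is at least its value at [z] because [E] maximizes it. *)
Lemma meets_top_defect u v E s1 s2 i : H E ->
  (forall z, H z -> dot z (u + v) <= dot E (u + v)) ->
  dot E u <= s1 -> meets_top u v s1 i -> meets_top u v s2 i ->
  s2 - s1 <= defect (F i) u v.
Proof.
move=> HE Emax Es1 [z1 [Fz1 z1u z1top]] [z2 [Fz2 z2u _]].
have := supportf_ub u (@Fc i) Fz2; have := supportf_ub v (@Fc i) Fz1.
suff : supportf (F i) (u + v) <= s1 + supportf (F i) v by rewrite /defect; lra.
apply: supportf_le => // z Fz; rewrite dotDr.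
have [zs|sz] := leP (dot z u) s1; first by rewrite lerD // supportf_ub.
have zE := Emax z (FH Fz); rewrite !dotDr in zE.
pose t := (s1 - dot E u) / (dot z u - dot E u).
have den : 0 < dot z u - dot E u by lra.
have tden : t * (dot z u - dot E u) = s1 - dot E u by rewrite divfK // gt_eqF.
have t0 : 0 <= t by apply: divr_ge0; lra.
have t1 : t <= 1 by rewrite ler_pdivrMr // mul1r; lra.
have Hw : H (t *: z + (1 - t) *: E).
  by apply: (iffLR (convex_setP H)) => //; [apply/andP|exact: FH Fz].
have := z1top _ Hw; rewrite !dotDl !dotZl => /(_ ltac:(lra)).
have := supportf_ub v (@Fc i) Fz1.
suff : dot z u + dot z v <= s1 + (t * dot z v + (1 - t) * dot E v) by lra.
have := ler_wpM2l (ltac:(by rewrite subr_ge0) : 0 <= 1 - t) zE; lra.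
Qed.

(** The maximum of [dot _ (u + v)] on [F i] does not exceed its value at [E],
    while [dot _ u] reaches [s] and [dot _ v] reaches [t]. *)
Lemma meets_top_right_defect u v E s t i : H E ->
  (forall z, H z -> dot z (u + v) <= dot E (u + v)) ->
  meets_top u v s i -> meets_top v u t i ->
  s - dot E u + (t - dot E v) <= defect (F i) u v.
Proof.
move=> HE Emax [z1 [Fz1 z1u _]] [z2 [Fz2 z2v _]].
have := supportf_ub u (@Fc i) Fz1; have := supportf_ub v (@Fc i) Fz2.
suff : supportf (F i) (u + v) <= dot E (u + v).
  by rewrite /defect [dot E _]dotDr; lra.
by apply: supportf_le => // z /FH; exact: Emax.
Qed.

(** The two arcs that start at [E] are joined into one interval, of length
    [defect H u v], whose classes are the sets of parameters met by one piece.
    *)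
Lemma defect_le_sum u v : H !=set0 ->
  (forall z, H z -> exists i, exists2 z', F i z' &
    dot z' u = dot z u /\ dot z' v = dot z v) ->
  defect H u v <= \sum_i defect (F i) u v.
Proof.
move=> H0 cov; have [E HE Euv] := supportf_attained (u + v) Hc H0.
have Emax z : H z -> dot z (u + v) <= dot E (u + v).
  by move=> Hz; rewrite Euv supportf_ub.
have Emax' z : H z -> dot z (v + u) <= dot E (v + u).
  by rewrite addrC; exact: Emax.
have cov' z : H z -> exists i, exists2 z', F i z' &
    dot z' v = dot z v /\ dot z' u = dot z u.
  by move=> /cov[i [z' Fz' []]]; exists i, z'.
(* t parametrizes the arc from a highest to a rightmost point, with t = 0 at E:
   by the abscissa to the right of E, by the ordinate to the left of it *)
pose P i t := (0 <= t /\ meets_top u v (dot E u + t) i) \/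
  (t <= 0 /\ meets_top v u (dot E v - t) i).
have -> : defect H u v =
    supportf H u - dot E u - (dot E v - supportf H v).
  by rewrite /defect -Euv dotDr; lra.
apply: (@interval_cover_le _ _ _ P) => [i|i t t'|t /andP[t0 t1]].
- exact: defect_ge0.
- move=> [[t0 Pt]|[t0 Pt]] [[t'0 Pt']|[t'0 Pt']] tt'.
  + by have := meets_top_defect HE Emax _ Pt Pt'; lra.
  + by have := defect_ge0 u v (@Fc i) (F0 i); lra.
  + by have := meets_top_right_defect HE Emax Pt' Pt; lra.
  + by have := meets_top_defect HE Emax' _ Pt' Pt; rewrite defectC; lra.
- have [tpos|tneg] := leP 0 t.
    have [|i Pi] := @meets_top_exists u v E (dot E u + t) HE _ cov; first lra.
    by exists i; [rewrite mem_index_enum|left].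
  have [|i Pi] := @meets_top_exists v u E (dot E v - t) HE _ cov'; first lra.
  by exists i; [rewrite mem_index_enum|right; split=> //; exact: ltW].
Qed.

End Defect.

(** * Fibres of planar projections *)

(** The flat to use is [z + V] with [V] a [k]-dimensional space of vectors
    orthogonal to both [u] and [v]. *)
Lemma impassable_fibre {R : realType} {d k n : nat}
    (F : 'I_n -> set 'rV[R]_d) (u v z : 'rV[R]_d) :
  (2 <= d)%N -> (k <= d - 2)%N -> impassable k F ->
  convex_hull (\bigcup_i F i) z ->
  exists i, exists2 z', F i z' & dot z' u = dot z u /\ dot z' v = dot z v.
Proof.
move=> d2 kd imp Hz.
pose M : 'M[R]_(d, 2) := \matrix_(i, j) (if j == 0 then u 0 i else v 0 i).
pose f : 'Hom('rV[R]_d, 'rV[R]_2) := linfun (mulmxr M).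
have fu w : w \in lker f -> dot w u = 0 /\ dot w v = 0.
  rewrite memv_ker lfunE /= => /eqP/rowP wM.
  by split; [have := wM 0|have := wM 1]; rewrite !mxE => <-;
    apply: eq_bigr => j _; rewrite mxE.
have kW : (k <= \dim (lker f))%N.
  have := limg_ker_dim f fullv; rewrite capfv dimvf /dim /= mul1n => dE.
  apply: (leq_trans kd); rewrite leq_subLR -[in leqLHS]dE addnC leq_add2r.
  by apply: leq_trans (dimvS (subvf _)) _; rewrite dimvf /dim /= mul1n.
pose X := take k (vbasis (lker f)).
have sX : size X = k by rewrite size_takel // size_tuple.
have fX : free X.
  have := basis_free (vbasisP (lker f)).
  rewrite -[X in free X](cat_take_drop k).
  exact: catl_free.
have XW : (<<X>> <= lker f)%VS.
  by apply/span_subvP => w /mem_take; exact: vbasis_mem.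
have [||i [w [[w0 /= w0X <-] Fw]]] :=
  imp (translate z [set w | w \in <<X>>%VS]).
- by exists z, <<X>>%VS; split=> //; move: fX; rewrite /free sX => /eqP.
- by exists z; split=> //; exists 0; rewrite /= ?mem0v ?addr0.
exists i, (z + w0) => //; have [wu wv] := fu _ (subvP XW _ w0X).
by rewrite !dotDl wu wv !addr0.
Qed.

(** * Homothets and their convex hull *)

Section Homothets.
Context {R : realType} {d : nat}.
Implicit Types (A C K : set 'rV[R]_d) (u v y : 'rV[R]_d) (t : R).

Lemma homothetE K y t : homothet K y t = (fun z => y + t *: z) @` K.
Proof. by rewrite /homothet /translate /dilate image_comp. Qed.

Lemma dilateE K t : dilate t K = homothet K 0 t.
Proof. by rewrite homothetE; apply: eq_imagel => z _ /=; rewrite add0r. Qed.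

Lemma homothet_nonempty K y t : K !=set0 -> homothet K y t !=set0.
Proof. by move=> [z Kz]; rewrite homothetE; exists (y + t *: z), z. Qed.

Lemma homothet_compact K y t : compact K -> compact (homothet K y t).
Proof.
move=> Kc; rewrite homothetE; apply: continuous_compact => //.
apply: continuous_subspaceT => z.
apply: continuousD; first exact: cst_continuous.
by apply: continuousZl_tmp; exact: cvg_id.
Qed.

Lemma homothet_convex K y t : @convex_set R 'rV[R]_d K ->
  @convex_set R 'rV[R]_d (homothet K y t).
Proof.
move=> /convex_setP Kv; rewrite homothetE; apply/convex_setP.
move=> _ _ s s01 [a Ka <-] [b Kb <-]; exists (s *: a + (1 - s) *: b).
  exact: Kv.
by apply/rowP => j; rewrite !mxE; ring.
Qed.

Lemma supportf_homothet K y t u : 0 <= t -> compact K -> K !=set0 ->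
  supportf (homothet K y t) u = dot y u + t * supportf K u.
Proof.
move=> t0 Kc K0; apply/eqP; rewrite eq_le; apply/andP; split.
  apply: supportf_le; first exact: homothet_nonempty.
  rewrite homothetE => _ [z Kz <-].
  by rewrite dotDl dotZl lerD2l ler_wpM2l // supportf_ub.
have [z Kz <-] := supportf_attained u Kc K0; rewrite -dotZl -dotDl.
apply: supportf_ub; first exact: homothet_compact.
by rewrite homothetE; exists z.
Qed.

Lemma defect_homothet K y t u v : 0 <= t -> compact K -> K !=set0 ->
  defect (homothet K y t) u v = t * defect K u v.
Proof.
by move=> t0 Kc K0; rewrite /defect !supportf_homothet // dotDr; ring.
Qed.

(** Keeping [a + b] as a factor, rather than normalizing it to 1, covers the
    case of zero weights. *)
Lemma convex_combination_weights A a b (p q : 'rV[R]_d) :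
  @convex_set R 'rV[R]_d A -> 0 <= a -> 0 <= b -> A p -> A q ->
  exists2 c, A c & a *: p + b *: q = (a + b) *: c.
Proof.
move=> /convex_setP Av a0 b0 Ap Aq.
have [ab0|abn0] := eqVneq (a + b) 0.
  have [-> ->] : a = 0 /\ b = 0 by split; lra.
  by exists p; rewrite // addr0 !scale0r addr0.
have ab : 0 < a + b by rewrite lt_neqAle eq_sym abn0 addr_ge0.
exists (a / (a + b) *: p + (1 - a / (a + b)) *: q).
  by apply: Av => //; rewrite divr_ge0 ?(ltW ab) //= ler_pdivrMr // mul1r lerDl.
rewrite scalerDr !scalerA; congr (_ *: _ + _ *: _); by field.
Qed.

Lemma convex_combination_sum A (I : Type) (r : seq I) (l : I -> R)
    (y : I -> 'rV[R]_d) :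
  @convex_set R 'rV[R]_d A -> A !=set0 -> (forall i, 0 <= l i) ->
  (forall i, A (y i)) ->
  exists2 c, A c & \sum_(i <- r) l i *: y i = (\sum_(i <- r) l i) *: c.
Proof.
move=> Av [c0 Ac0] l0 Ay; elim: r => [|i r [c Ac IH]].
  by exists c0; rewrite // !big_nil scale0r.
have [c' Ac' E] := convex_combination_weights Av (l0 i)
  (ltac:(exact: sumr_ge0) : 0 <= \sum_(i <- r) l i) (Ay i) Ac.
by exists c'; rewrite // !big_cons IH E.
Qed.

End Homothets.

Section HomothetHull.
Context {R : realType} {d n : nat}.
Variables (K : set 'rV[R]_d) (x : 'I_n -> 'rV[R]_d) (tau : 'I_n -> R).
Hypotheses (Kc : compact K) (Kv : @convex_set R 'rV[R]_d K).
Hypothesis tau0 : forall i, 0 <= tau i.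

Definition simplex : set 'rV[R]_n :=
  [set l | (forall i, 0 <= l 0 i) /\ \sum_i l 0 i = 1].

Lemma simplex_compact : compact simplex.
Proof.
apply: (@subclosed_compact _ _
  [set l : 'rV[R]_n | forall i, `[0, 1]%classic (l ord0 i)]).
- have -> : simplex = (\bigcap_(i in setT) [set l : 'rV[R]_n | 0 <= l 0 i]) `&`
      [set l | dot l (const_mx 1) = 1].
    have sumE (l : 'rV[R]_n) : dot l (const_mx 1) = \sum_i l 0 i.
      by apply: eq_bigr => i _; rewrite mxE mulr1.
    apply/seteqP; split=> l [l0 l1]; split=> //=; last by rewrite -sumE.
    - by move=> i _; exact: l0.
    - by rewrite sumE.
    - by move=> i; exact: l0.
  apply: closedI.
    apply: closed_bigI => i _.
    apply: (@closed_comp _ _ (fun l : 'rV[R]_n => l 0 i) [set a | 0 <= a]).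
      by move=> l _; exact: coord_continuous.
    exact: closed_ge.
  apply: (@closed_comp _ _ (dot^~ _) [set a | a = 1]); last exact: closed_eq.
  by move=> z _; exact: dot_continuous.
- apply: (@rV_compact _ _ (fun i => `[0 : R, 1 : R]%classic)) => i.
  exact: segment_compact.
- move=> l [l0 l1] i /=; rewrite in_itv /= l0 /= -l1 (bigD1 i) //= lerDl.
  exact: sumr_ge0.
Qed.

Definition hull_point (p : 'rV[R]_n * 'rV[R]_d) : 'rV[R]_d :=
  \sum_i p.1 0 i *: x i + (\sum_i p.1 0 i * tau i) *: p.2.

Lemma hull_point_continuous : continuous hull_point.
Proof.
have coord i : continuous (fun p : 'rV[R]_n * 'rV[R]_d => p.1 0 i).
  move=> p; apply: (@continuous_comp _ _ _ fst (fun l : 'rV[R]_n => l 0 i)).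
    exact: cvg_fst.
  exact: coord_continuous.
have xs : continuous (fun p : 'rV[R]_n * 'rV[R]_d => \sum_i p.1 0 i *: x i).
  apply: continuous_big => [|i _ p]; first exact: add_continuous.
  by apply: continuousZr_tmp; exact: coord.
have ts : continuous (fun p : 'rV[R]_n * 'rV[R]_d => \sum_i p.1 0 i * tau i).
  apply: continuous_big => [|i _ p]; first exact: add_continuous.
  by apply: continuousM; [exact: coord|exact: cst_continuous].
move=> p; apply: (continuousD (xs p)).
by apply: continuousZ; [exact: ts|exact: cvg_snd].
Qed.

(** By convexity of [K], combining points of the homothets with weights [l i]
    gives a point of the homothet with centre [\sum_i l i *: x i] and ratio
    [\sum_i l i * tau i]. Hence weights and a single point of [K] suffice to
    parametrize the hull, and the parameter space is compact. *)
Lemma convex_hull_homothets :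
  convex_hull (\bigcup_i homothet K (x i) (tau i)) =
  hull_point @` (simplex `*` K).
Proof.
apply/seteqP; split.
  apply: smallest_sub.
    apply/convex_setP => _ _ t /andP[t0 t1] [[l z] [[/= l0 l1] Kz] <-]
      [[m w] [[/= m0 m1] Kw] <-].
    have s0 : 0 <= 1 - t by lra.
    have [c Kc' E] := convex_combination_weights Kv
      (mulr_ge0 t0 (ltac:(apply: sumr_ge0 => i _; exact: mulr_ge0) :
        0 <= \sum_i l 0 i * tau i))
      (mulr_ge0 s0 (ltac:(apply: sumr_ge0 => i _; exact: mulr_ge0) :
        0 <= \sum_i m 0 i * tau i)) Kz Kw.
    exists (t *: l + (1 - t) *: m, c); first split=> //=; first split=> [i|].
    - by rewrite !mxE addr_ge0 // mulr_ge0.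
    - under eq_bigr do rewrite !mxE.
      by rewrite big_split /= -!mulr_sumr l1 m1; lra.
    rewrite /hull_point /= !scalerDr addrACA !scalerA E; congr (_ + _ *: _).
      rewrite !scaler_sumr -big_split; apply: eq_bigr => i _.
      by rewrite !mxE /= !scalerA -scalerDl.
    rewrite !mulr_sumr -big_split; apply: eq_bigr => i _.
    by rewrite !mxE /=; ring.
  move=> y [i _]; rewrite homothetE => -[z Kz <-{y}].
  have delta j : (delta_mx 0 i : 'rV[R]_n) 0 j = (j == i)%:R.
    by rewrite mxE eqxx.
  exists (delta_mx 0 i, z); first split=> //=; first split=> [j|].
  - by rewrite delta ler0n.
  - rewrite (bigD1 i) //= delta eqxx big1 ?addr0 // => j /negPf ji.
    by rewrite delta ji.
  rewrite /hull_point /=; congr (_ + _ *: _); rewrite (bigD1 i) //= delta eqxx.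
    by rewrite scale1r big1 ?addr0 // => j /negPf ji; rewrite delta ji scale0r.
  by rewrite mul1r big1 ?addr0 // => j /negPf ji; rewrite delta ji mul0r.
move=> _ [[l z] [[/= l0 l1] Kz] <-] C [Cv FC].
have Cy i : C (x i + tau i *: z).
  by apply: FC; exists i => //; rewrite homothetE; exists z.
have C0 : C !=set0.
  case: (pickP 'I_n) => [i _|none]; first by exists (x i + tau i *: z).
  by move: l1; rewrite big_pred0 // => /eqP; rewrite eq_sym oner_eq0.
have [c Cc] := convex_combination_sum (index_enum 'I_n) Cv C0 l0 Cy.
rewrite l1 scale1r => cE; rewrite (_ : hull_point _ = c) // -cE.
rewrite /hull_point /= scaler_suml -big_split; apply: eq_bigr => i _.
by rewrite scalerDr scalerA.
Qed.

Lemma convex_hull_homothets_compact :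
  compact (convex_hull (\bigcup_i homothet K (x i) (tau i))).
Proof.
rewrite convex_hull_homothets; apply: continuous_compact.
  by apply: continuous_subspaceT; exact: hull_point_continuous.
by apply: compact_setX => //; exact: simplex_compact.
Qed.

End HomothetHull.

Lemma convex_hull_convex {R : realType} {d : nat} (A : set 'rV[R]_d) :
  @convex_set R 'rV[R]_d (convex_hull A).
Proof.
apply/convex_setP => z w t t01 Az Aw C [Cv AC].
by apply: (iffLR (convex_setP C)) => //; [exact: Az|exact: Aw].
Qed.

(** * Free sliding *)

Lemma summand_slides_freely {R : realType} {d : nat} (H S : set 'rV[R]_d) :
  closed S -> summand H S -> slides_freely H S.
Proof.
move=> Sc [C [_ _ _ HCS]] z [/Sc]; rewrite -{1}HCS => -[h Hh [c Cc <-]] _.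
exists c; split; first by exists h => //; rewrite addrC.
move=> _ [w Hw <-]; rewrite -HCS; exists w => //; exists c => //.
by rewrite addrC.
Qed.

(** * The least covering ratio *)

Lemma convex_body_nondegenerate {R : realType} {d : nat} (K : set 'rV[R]_d) :
  (0 < d)%N -> convex_body K -> exists p q, [/\ K p, K q & p != q].
Proof.
case: d K => // d K _ [_ _ [p Kp]].
pose f (t : R) : 'rV[R]_d.+1 := p + t *: delta_mx 0 0.
have f0 : f 0 = p by rewrite /f scale0r addr0.
have fc : {for 0, continuous f}.
  apply: continuousD; first exact: cst_continuous.
  by apply: continuousZr_tmp; exact: cvg_id.
have /nbhs_ballP[e /= e0 eK] : nbhs 0 (f @^-1` K) by apply: fc; rewrite f0.
have Kfe : K (f (e / 2)).
  by apply: eK; rewrite -ball_normE /= sub0r normrN gtr0_norm; lra.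
exists p, (f (e / 2)); split=> //; first exact: nbhs_singleton.
apply/eqP => /rowP/(_ 0); rewrite !mxE eqxx /=; lra.
Qed.

Section Lambda.
Context {R : realType} {d n : nat}.
Variables (K : set 'rV[R]_d) (x : 'I_n -> 'rV[R]_d) (tau : 'I_n -> R).
Hypotheses (d0 : (0 < d)%N) (n0 : (0 < n)%N) (hK : convex_body K)
  (tau0 : forall i, 0 < tau i).

Let T : R := \sum_i tau i.

(** The covering condition for the pair [q] of a ratio and a centre, as a
    family of inequalities between support functions. These are affine in [q],
    which makes closedness evident. *)
Definition covers_at (q : R * 'rV[R]_d) : Prop :=
  forall i u, dot (x i) u + tau i * supportf K u <=
    dot q.2 u + q.1 * T * supportf K u.

Let Kc : compact K. Proof. by case: hK. Qed.
Let Kv : @convex_set R 'rV[R]_d K. Proof. by case: hK. Qed.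
Let K0 : K !=set0.
Proof. by case: hK => _ _ [p /nbhs_singleton]; exists p. Qed.

Lemma sum_ratios_ge0 : 0 <= T.
Proof. by apply: sumr_ge0 => i _; exact: ltW. Qed.

Lemma covers_atP l y : 0 <= l ->
  (\bigcup_i homothet K (x i) (tau i) `<=` translate y (dilate (l * T) K)) <->
  covers_at (l, y).
Proof.
move=> l0; rewrite -/(homothet K y (l * T)).
have lT : 0 <= l * T by rewrite mulr_ge0 // sum_ratios_ge0.
have hc : compact (homothet K y (l * T)) by exact: homothet_compact.
split=> [cov i u|cov z [i _ Fz]].
  rewrite /= -!supportf_homothet //; last exact: ltW.
  apply: supportf_subset => //; first exact: homothet_nonempty.
  by move=> z Fz; apply: cov; exists i.
apply/mem_supportfP => //.
- exact: homothet_convex.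
- exact: homothet_nonempty.
move=> u; rewrite supportf_homothet //.
apply: le_trans (cov i u); rewrite -supportf_homothet //; last exact: ltW.
by apply: supportf_ub => //; exact: homothet_compact.
Qed.

(** A bound on the centre comes from the inequalities in the coordinate
    directions and their opposites, for any single member of the family. *)
Lemma covers_at_compact :
  compact [set q : R * 'rV[R]_d | 0 <= q.1 <= 1 /\ covers_at q].
Proof.
have T0 := sum_ratios_ge0.
pose i0 := Ordinal n0; pose h := supportf K.
pose e j : 'rV[R]_d := delta_mx 0 j.
pose lo j := dot (x i0) (e j) + tau i0 * h (e j) - T * `|h (e j)|.
pose hi j := dot (x i0) (e j) - tau i0 * h (- e j) + T * `|h (- e j)|.
apply: (@subclosed_compact _ _
  (`[0 : R, 1 : R]%classic `*` [set y : 'rV[R]_d | forall j,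
     `[lo j, hi j]%classic (y ord0 j)])).
- have -> : [set q : R * 'rV[R]_d | 0 <= q.1 <= 1 /\ covers_at q] =
      [set q | 0 <= q.1] `&` [set q | q.1 <= 1] `&`
      \bigcap_(iu in [set: 'I_n * 'rV[R]_d])
        [set q | dot (x iu.1) iu.2 + tau iu.1 * h iu.2 <=
           dot q.2 iu.2 + q.1 * T * h iu.2].
    apply/seteqP; split=> [q [/andP[q0 q1] qc]|q [[q0 q1] qc]].
      by split=> // -[i u] _; exact: qc.
    by split=> [|i u]; [apply/andP|exact: (qc (i, u))].
  apply: closedI; first apply: closedI.
  + apply: (@closed_comp _ _ fst [set a : R | 0 <= a]); last exact: closed_ge.
    by move=> q _; exact: cvg_fst.
  + apply: (@closed_comp _ _ fst [set a : R | a <= 1]); last exact: closed_le.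
    by move=> q _; exact: cvg_fst.
  apply: closed_bigI => -[i u] _ /=.
  apply: (@closed_comp _ _ (fun q : R * 'rV[R]_d => dot q.2 u + q.1 * T * h u)
    [set a | _ <= a]); last exact: closed_ge.
  have dot_cont : continuous (fun q : R * 'rV[R]_d => dot q.2 u).
    move=> q; apply: (@continuous_comp _ _ _ snd (dot^~ u)).
      exact: cvg_snd.
    exact: dot_continuous.
  have scale_cont : continuous (fun q : R * 'rV[R]_d => q.1 * T * h u).
    have fst_cont (q : R * 'rV[R]_d) : {for q, continuous fst}.
      exact: cvg_fst.
    move=> q; do 2![apply: (fun h => continuousM h (@cst_continuous _ _ _ q))].
    exact: fst_cont.
  by move=> q _; exact: (continuousD (dot_cont q) (scale_cont q)).
- apply: compact_setX; first exact: segment_compact.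
  apply: (@rV_compact _ _ (fun j => `[lo j, hi j]%classic)) => j.
  exact: segment_compact.
- move=> [l y] [/= l01 cov]; split=> [|j] /=; rewrite in_itv //=.
  have lTh (a : R) : l * T * a <= T * `|a|.
    case/andP: l01 => l0 l1; rewrite -mulrA.
    apply: (@le_trans _ _ (l * (T * `|a|))).
      by rewrite ler_wpM2l // ler_wpM2l // ler_norm.
    by rewrite ler_piMl // mulr_ge0.
  have := cov i0 (e j); have := cov i0 (- e j).
  have := lTh (h (e j)); have := lTh (h (- e j)).
  rewrite /lo /hi /= !dotNr !(dot_delta y) -/h => h1 h2 h3 h4.
  by apply/andP; split; lra.
Qed.

(** The least ratio is positive because a homothet of [K] has positive width in
    some direction [p - q], whereas ratio 0 covers a point only. *)
Lemma is_lambda_le1 : covering_ratio K x tau 1 ->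
  exists l : R, is_lambda K x tau l /\ l <= 1.
Proof.
move=> [_ [y1 /(covers_atP _ ler01) cov1]].
pose P := [set q : R * 'rV[R]_d | 0 <= q.1 <= 1 /\ covers_at q].
have P1 : P (1, y1) by split; rewrite //= ler01 lexx.
have P0 : P !=set0 by exists (1, y1).
have [|[l y] Ply lmin] := compact_EVT_min (f := fst) P0 covers_at_compact.
  by apply: continuous_subspaceT => q; exact: cvg_fst.
have {Ply} [/= /andP[l0 l1] cov] := set_mem Ply.
have l_gt0 : 0 < l.
  rewrite lt_neqAle l0 andbT eq_sym; apply/eqP => lE; rewrite {}lE in cov.
  have [p [q [Kp Kq pq]]] := convex_body_nondegenerate d0 hK.
  have : 0 < dot (p - q) (p - q) by rewrite dotxx_gt0 // subr_eq0.
  have := supportf_ub (p - q) Kc Kp; have := supportf_ub (- (p - q)) Kc Kq.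
  have := cov (Ordinal n0) (p - q); have := cov (Ordinal n0) (- (p - q)).
  rewrite /= !mul0r !addr0 !dotNr [dot (p - q) _]dotDl dotNl.
  set u := p - q => h1 h2 h3 h4 h5.
  have : tau (Ordinal n0) * (supportf K u + supportf K (- u)) <= 0 by lra.
  by rewrite pmulr_rle0 //; lra.
exists l; split=> //; split; first by split=> //; exists y; apply/covers_atP.
move=> m [m0 [z /(covers_atP _ (ltW m0)) covm]].
have [m1|/ltW m1] := leP m 1; last exact: le_trans l1 m1.
by apply: (lmin (m, z)); apply: mem_set; split=> //=; rewrite ltW.
Qed.

End Lambda.

(** * Hulls of impassable families *)

Theorem theorem5 (R : realType) (d k n : nat)
    (hd : (2 <= d)%N) (hk : (k <= d - 2)%N) (hn : (0 < n)%N)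
    (K : set 'rV[R]_d) (hK : convex_body K)
    (x : 'I_n -> 'rV[R]_d) (tau : 'I_n -> R)
    (htau : forall i : 'I_n, 0 < tau i)
    (hIP : impassable k (fun i : 'I_n => homothet K (x i) (tau i))) :
  let H := convex_hull (\bigcup_i homothet K (x i) (tau i)) in
  let S := dilate (\sum_(i < n) tau i) K in
  [/\ slides_freely H S,
      summand H S
    & exists l : R, is_lambda K x tau l /\ l <= 1].
Proof.
move=> H S.
have [Kc Kv [p /nbhs_singleton Kp]] := hK; have K0 : K !=set0 by exists p.
have tau0 i : 0 <= tau i by exact: ltW.
have T0 : 0 <= \sum_i tau i by exact: sumr_ge0.
have SE : S = homothet K 0 (\sum_i tau i) by rewrite /S dilateE.
have Sc : compact S by rewrite SE; exact: homothet_compact.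
have Hc : compact H by exact: convex_hull_homothets_compact.
have Hv : @convex_set R 'rV[R]_d H by exact: convex_hull_convex.
have FH i : homothet K (x i) (tau i) `<=` H.
  by move=> z Fz; apply: sub_gen_smallest; exists i.
have H0 : H !=set0.
  have [z Fz] := homothet_nonempty (x (Ordinal hn)) (tau (Ordinal hn)) K0.
  by exists z; exact: FH Fz.
have HS : summand H S.
  apply: summand_defect => //; rewrite ?SE.
  - exact: homothet_convex.
  - exact: homothet_nonempty.
  move=> u v; rewrite defect_homothet // mulr_suml.
  have := @defect_le_sum _ _ _ H (fun i => homothet K (x i) (tau i)) Hc Hv.
  move=> /(_ (fun i => homothet_compact Kc)).
  move=> /(_ (fun i => homothet_nonempty (x i) (tau i) K0) FH u v H0).
  under eq_bigr do rewrite defect_homothet //.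
  by apply=> z; exact: impassable_fibre hIP.
split=> //.
  apply: summand_slides_freely => //.
  exact: (compact_closed (@norm_hausdorff _ _)).
apply: is_lambda_le1 => //; first exact: ltnW.
have [C [[c Cc] _ _ HC]] := HS.
split=> //; exists (- c) => z Fz; rewrite mul1r.
have Hz : H z by exact: sub_gen_smallest.
have : S (z + c) by rewrite -HC; exists z => //; exists c.
by exists (z + c) => //; rewrite addrC addrK.
Qed.
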